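(* Let $X$ be a graded $\Bbbk$-module (chain complex with trivial differential), let $\mathcal A_\infty\to\mathcal E(X)$ be a minimal $A$-infinity algebra structure on $\Sigma^{-1}X$ with operations $m_n$, $n\ge2$, and let $A$ be the graded associative algebra $\Sigma^{-1}X$ with shifted multiplication $m_2$. In the Bousfield--Kan spectral sequence of the tower of mapping spaces $\operatorname{Map}_{\mathrm{dgOp}}(\mathcal A_{n},\mathcal E(X))$, $n\ge2$ (based at this structure), the pointed set $E_2^{00}$ is the set of graded associative algebra structures on $\Sigma^{-1}X$, and the base point is $A$.
   Context: $\Bbbk$ is a commutative ring; operads are non-symmetric; differentials have degree $-1$. For elements of an operad with partial compositions $\circ_i$ write $x\{y\}=\sum_i x\circ_i y$. $\mathcal E(X)(n)=\operatorname{Hom}(X^{\otimes n},X)$ is the endomorphism operad. $\mathcal A_\infty$ (in operadic suspension convention) is the DG-operad which as a graded operad is free on generators $\mu_n$, $n\ge2$, of arity $n$ and degree $-1$, with $d(\mu_n)=\sum_{p+q=n+1,\,p,q\ge2}\mu_p\{\mu_q\}$; $\mathcal A_m\subset\mathcal A_\infty$ is the sub-DG-operad freely generated by $\mu_2,\dots,\mu_m$. An $\mathcal A_n$-structure on $\Sigma^{-1}X$ is a DG-operad map $\mathcal A_n\to\mathcal E(X)$; the image of $\mu_i$ is $m_i\in\operatorname{Hom}(X^{\otimes i},X)_{-1}$. A graded algebra product on $\Sigma^{-1}X$ corresponds to a shifted multiplication $m_2\in\operatorname{Hom}(X\otimes X,X)_{-1}$ by $m_2(\sigma x\otimes\sigma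 y)=(-1)^{|x|+1}\sigma(x\cdot y)$. DG-operads carry the model structure with quasi-isomorphisms as weak equivalences and surjections as fibrations; $\operatorname{Map}_{\mathrm{dgOp}}$ is its mapping space. The tower is $X_n=\operatorname{Map}_{\mathrm{dgOp}}(\mathcal A_{n+2},\mathcal E(X))$ for $n\ge0$, $X_n=*$ for $n<0$, based by restriction of the given structure, and $X_{r,m}$ is the homotopy fiber of $X_r\to X_m$. The Bousfield--Kan term $E_r^{st}$, $t\ge s\ge0$, consists of the elements of $\pi_{t-s}X_{s,s-1}$ whose image in $\pi_{t-s}X_s$ lifts to $\pi_{t-s}X_{s+r-1}$, modulo the image (or action, if $t=s$) of $\ker[\pi_{t-s+1}X_{s-1}\to\pi_{t-s+1}X_{s-r}]$. In particular $E_2^{00}=\operatorname{Im}[\pi_0X_1\to\pi_0X_0]$. *)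

(* Defs.v *)
From HB Require Import structures.
From mathcomp Require Import all_boot all_order all_algebra.
From mathcomp Require Import zify.
From mathcomp Require Import all_classical.
From Stdlib Require Import Relations.

Set Implicit Arguments.
Unset Strict Implicit.
Unset Printing Implicit Defensive.

Import GRing.Theory.
Local Open Scope classical_set_scope.
Local Open Scope ring_scope.

Definition ksign (k : comPzRingType) (e : int) : k := (-1) ^+ `|e|%N.

Section Sign.
Variable k : comPzRingType.
Local Notation ksign := (ksign k).

Lemma ksignD a b : ksign (a + b) = ksign a * ksign b.
Proof.
rewrite /ksign -exprD -[LHS]signr_odd -[RHS]signr_odd; congr (_ ^+ nat_of_bool _); lia.
Qed.

Lemma ksign0 : ksign 0 = 1. Proof. by []. Qed.
Lemma ksign_sq a : ksign a * ksign a = 1.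
Proof. by rewrite /ksign -expr2 -exprM mulnC exprM sqrrN expr1n expr1n. Qed.

End Sign.

(* A graded k-module is the direct sum of its homogeneous components; the
   decomposition is given by the projections gpr p onto the degree p part. *)
Record gmod (k : comPzRingType) := Gmod {
  gcar :> lmodType k;
  gpr : int -> {linear gcar -> gcar};
  gpr_idem : forall p q x, gpr p (gpr q x) = if p == q then gpr q x else 0;
  gpr_fin : forall x, finite_set [set p | gpr p x != 0];
  gpr_sum : forall x, x = \sum_(p \in [set: int]) gpr p x }.

Definition homog (k : comPzRingType) (V : gmod k) (p : int) (x : V) : Prop :=
  gpr V p x = x.

(* x |-> (-1)^(e|x|) x *)
Definition gsgn (k : comPzRingType) (V : gmod k) (e : int) (x : V) : V :=
  \sum_(p \in [set: int]) ksign k (e * p) *: gpr V p x.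

Section GradedModule.
Variables (k : comPzRingType) (V : gmod k).
Implicit Types (x y : V) (p q e : int).

Lemma gpr_supp x : exists2 s : seq int, uniq s & forall p, p \notin s -> gpr V p x = 0.
Proof.
have /finite_seqP[s hs] := gpr_fin x.
exists (undup s); first exact: undup_uniq.
move=> p; rewrite mem_undup => ps; apply/eqP; apply/negP => /negP h.
have : [set` s] p by rewrite -hs.
by rewrite /= (negbTE ps).
Qed.

Lemma fsbig_supp_seq (F : int -> V) (s : seq int) :
  uniq s -> (forall p, p \notin s -> F p = 0) ->
  \sum_(p \in [set: int]) F p = \sum_(p <- s) F p.
Proof.
move=> us h; rewrite -(fsbig_widen [set` s]) //=.
  by rewrite -fsbig_seq.
by move=> p [_ /= /negP ps]; exact: h.
Qed.

Lemma gpr_ext x y : (forall p, gpr V p x = gpr V p y) -> x = y.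
Proof.
move=> h; rewrite (gpr_sum x) (gpr_sum y).
by apply: eq_fsbigr => p _; exact: h.
Qed.

Lemma gpr_gsgn q e x : gpr V q (gsgn e x) = ksign k (e * q) *: gpr V q x.
Proof.
have [s us hs] := gpr_supp x.
rewrite /gsgn (fsbig_supp_seq us); last by move=> p /hs ->; rewrite scaler0.
rewrite linear_sum /=.
have [qs|qs] := boolP (q \in s); last first.
  rewrite (hs _ qs) scaler0 big_seq big1 // => p ps.
  rewrite linearZ /= gpr_idem; case: eqP => [E|]; last by rewrite scaler0.
  by move: qs; rewrite E ps.
rewrite (bigD1_seq q) //= linearZ /= gpr_idem eqxx big1 ?addr0 // => p /negbTE pq.
by rewrite linearZ /= gpr_idem eq_sym pq scaler0.
Qed.

Lemma gsgn_lin e a x y : gsgn e (a *: x + y) = a *: gsgn e x + gsgn e y.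
Proof.
apply: gpr_ext => p; rewrite [RHS]linearP !gpr_gsgn linearP /=.
by rewrite scalerDr !scalerA [a * _]mulrC.
Qed.

Lemma gsgnD e e' x : gsgn e (gsgn e' x) = gsgn (e + e') x.
Proof. by apply: gpr_ext => p; rewrite !gpr_gsgn scalerA -ksignD mulrDl. Qed.

Lemma gsgn0 x : gsgn 0 x = x.
Proof. by apply: gpr_ext => p; rewrite gpr_gsgn mul0r scale1r. Qed.

Lemma homog_gpr p x : homog p (gpr V p x).
Proof. by rewrite /homog gpr_idem eqxx. Qed.

Lemma homogP p q x : homog p x -> gpr V q x = if q == p then x else 0.
Proof. by move=> hx; rewrite -{1}hx gpr_idem hx. Qed.

Lemma gsgn_homog e p x : homog p x -> gsgn e x = ksign k (e * p) *: x.
Proof.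
move=> hx; apply: gpr_ext => q; rewrite gpr_gsgn linearZ /= (homogP _ hx).
by case: eqP => [->|]; rewrite ?scaler0.
Qed.

Lemma homog_lin p a x y : homog p x -> homog p y -> homog p (a *: x + y).
Proof. by rewrite /homog linearP => -> ->. Qed.

Lemma homog0 p : homog p (0 : V).
Proof. by rewrite /homog linear0. Qed.

Lemma homog_gsgn e p x : homog p x -> homog p (gsgn e x).
Proof. by move=> hx; rewrite (gsgn_homog _ hx) /homog linearZ /= hx. Qed.

End GradedModule.

Section Desuspension.
Variables (k : comPzRingType) (X : gmod k).

Fact desusp_idem p q (x : X) :
  gpr X (p + 1) (gpr X (q + 1) x) = if p == q then gpr X (q + 1) x else 0.
Proof. by rewrite gpr_idem (inj_eq (addIr 1)). Qed.

Fact desusp_fin (x : X) : finite_set [set p | gpr X (p + 1) x != 0].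
Proof.
rewrite (_ : [set p | _] = (fun p => p + 1) @^-1` [set p | gpr X p x != 0]) //.
by apply: finite_preimage; [move=> p q _ _ /addIr | exact: gpr_fin].
Qed.

Fact desusp_sum (x : X) : x = \sum_(p \in [set: int]) gpr X (p + 1) x.
Proof.
rewrite {1}(gpr_sum x).
apply: (reindex_fsbigT (fun p : int => p + 1) (fun p => gpr X p x)).
by exists (fun p => p - 1) => p; rewrite ?addrK ?subrK.
Qed.

(* Sigma^-1 X has the carrier of X, and (Sigma^-1 X)_p = X_(p+1). *)
Definition desusp : gmod k :=
  @Gmod k (gcar X) (fun p => gpr X (p + 1)) desusp_idem desusp_fin desusp_sum.

Definition sigma (x : desusp) : X := x.
Definition sigma_inv (x : X) : desusp := x.

End Desuspension.

(* Non-symmetric graded operads.  The arity l = m + n - 1 and the degree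
   r = p + q of x o_i y are arguments, together with proofs of the equations,
   so that no casts are needed; indices i are counted from 0. *)
Record grOperad (k : comPzRingType) := GrOperad {
  op :> nat -> int -> lmodType k;
  op1 : op 1 0;
  circ : forall m n l p q r, (m + n = l.+1)%N -> p + q = r ->
    op m p -> 'I_m -> op n q -> op l r;
  circ_linl : forall m n l p q r (E : (m + n = l.+1)%N) (D : p + q = r)
    (a : k) (x x' : op m p) i (y : op n q),
    circ E D (a *: x + x') i y = a *: circ E D x i y + circ E D x' i y;
  circ_linr : forall m n l p q r (E : (m + n = l.+1)%N) (D : p + q = r)
    (a : k) (x : op m p) i (y y' : op n q),
    circ E D x i (a *: y + y') = a *: circ E D x i y + circ E D x i y';
  circ1l : forall n q (E : (1 + n = n.+1)%N) (D : 0 + q = q) i (y : op n q),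
    circ E D op1 i y = y;
  circ1r : forall m p (E : (m + 1 = m.+1)%N) (D : p + 0 = p) (x : op m p) i,
    circ E D x i op1 = x;
  circA : forall m n o l1 l2 l p q r d1 d2 d
    (E1 : (m + n = l1.+1)%N) (D1 : p + q = d1)
    (E2 : (n + o = l2.+1)%N) (D2 : q + r = d2)
    (E3 : (l1 + o = l.+1)%N) (D3 : d1 + r = d)
    (E4 : (m + l2 = l.+1)%N) (D4 : p + d2 = d)
    (x : op m p) (y : op n q) (z : op o r)
    (i : 'I_m) (j : 'I_n) (h : 'I_l1), h = (i + j)%N :> nat ->
    circ E3 D3 (circ E1 D1 x i y) h z = circ E4 D4 x i (circ E2 D2 y j z);
  circC : forall m n o l1 l2 l p q r d1 d2 d
    (E1 : (m + n = l1.+1)%N) (D1 : p + q = d1)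
    (E2 : (m + o = l2.+1)%N) (D2 : p + r = d2)
    (E3 : (l1 + o = l.+1)%N) (D3 : d1 + r = d)
    (E4 : (l2 + n = l.+1)%N) (D4 : d2 + q = d)
    (x : op m p) (y : op n q) (z : op o r)
    (i j : 'I_m) (i' : 'I_l2) (j' : 'I_l1), (i < j)%N ->
    i' = i :> nat -> j'.+1 = (j + n)%N ->
    circ E3 D3 (circ E1 D1 x i y) j' z =
      ksign k (q * r) *: circ E4 D4 (circ E2 D2 x j z) i' y }.

Record grHom (k : comPzRingType) (P Q : grOperad k) := GrHom {
  gr_map :> forall n p, {linear P n p -> Q n p};
  gr_map1 : gr_map 1%N 0 (op1 P) = op1 Q;
  gr_map_circ : forall m n l p q r (E : (m + n = l.+1)%N) (D : p + q = r)
    (x : P m p) i (y : P n q),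
    gr_map l r (circ E D x i y) = circ E D (gr_map m p x) i (gr_map n q y) }.

(* The target degree r = p - 1 of the differential is also an argument. *)
Record dgOperad (k : comPzRingType) := DgOperad {
  dg_gr :> grOperad k;
  diff : forall n p r, p = r + 1 -> {linear dg_gr n p -> dg_gr n r};
  diffK : forall n p r s (Hp : p = r + 1) (Hr : r = s + 1) (x : dg_gr n p),
    diff n Hr (diff n Hp x) = 0;
  diff_circ : forall m n l p q r p' q' r' (E : (m + n = l.+1)%N) (D : p + q = r)
    (Hp : p = p' + 1) (Hq : q = q' + 1) (Hr : r = r' + 1)
    (Dp : p' + q = r') (Dq : p + q' = r') (x : dg_gr m p) i (y : dg_gr n q),
    diff l Hr (circ E D x i y) =
      circ E Dp (diff m Hp x) i y + ksign k p *: circ E Dq x i (diff n Hq y) }.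

Record dgHom (k : comPzRingType) (P Q : dgOperad k) := DgHom {
  dg_map :> grHom P Q;
  dg_map_diff : forall n p r (H : p = r + 1) (x : P n p),
    dg_map n r (diff P n H x) = diff Q n H (dg_map n p x) }.

Section Morphisms.
Variable k : comPzRingType.

Lemma grHom_ext (P Q : grOperad k) (f g : grHom P Q) :
  (forall n p x, f n p x = g n p x) -> f = g.
Proof.
case: f g => f f1 fc [g g1 gc] /= H.
have E : f = g.
  apply: functional_extensionality_dep => n; apply: functional_extensionality_dep => p.
  have /funext Hnp := H n p.
  move: Hnp; case: (f n p) (g n p) => u [[Uu] [Vu]] [v [[Uv] [Vv]]] /= Euv.
  by subst v; congr GRing.Linear.Pack; congr GRing.Linear.Class;
    [congr GRing.isNmodMorphism.Axioms_ | congr GRing.isScalable.Axioms_];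
    exact: Prop_irrelevance.
by subst g; congr GrHom; exact: Prop_irrelevance.
Qed.

Lemma dgHom_ext (P Q : dgOperad k) (f g : dgHom P Q) :
  (forall n p x, f n p x = g n p x) -> f = g.
Proof.
case: f g => f fd [g gd] /= /grHom_ext E.
by subst g; congr DgHom; exact: Prop_irrelevance.
Qed.

Definition grComp (P Q R : grOperad k) (g : grHom Q R) (f : grHom P Q) : grHom P R.
Proof.
refine (@GrHom k P R (fun n p => (g n p \o f n p)%FUN) _ _).
- by rewrite /= !gr_map1.
- by move=> *; rewrite /= !gr_map_circ.
Defined.

Definition dgComp (P Q R : dgOperad k) (g : dgHom Q R) (f : dgHom P Q) : dgHom P R.
Proof.
refine (@DgHom k P R (grComp g f) _).
by move=> *; rewrite /= !dg_map_diff.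
Defined.

End Morphisms.

Section Circ0.
Variables (k : comPzRingType) (P : grOperad k).

Lemma circ0l m n l p q r (E : (m + n = l.+1)%N) (D : p + q = r) i (y : P n q) :
  circ E D (0 : P m p) i y = 0.
Proof.
have := circ_linl E D (-1) (0 : P m p) 0 i y.
by rewrite scaler0 addr0 scaleN1r addNr.
Qed.

Lemma circ0r m n l p q r (E : (m + n = l.+1)%N) (D : p + q = r) (x : P m p) i :
  circ E D x i (0 : P n q) = 0.
Proof.
have := circ_linr E D (-1) x i (0 : P n q) 0.
by rewrite scaler0 addr0 scaleN1r addNr.
Qed.

End Circ0.

Definition upd (T : Type) (n : nat) (x : 'I_n -> T) (i : 'I_n) (u : T) : 'I_n -> T :=
  fun j => if j == i then u else x j.

Section EndomorphismOperad.
Variables (k : comPzRingType) (X : gmod k).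

Definition multilin (n : nat) (f : ('I_n -> X) -> X) : Prop :=
  forall i x (a : k) u v,
    f (upd x i (a *: u + v)) = a *: f (upd x i u) + f (upd x i v).

Definition has_deg (n : nat) (d : int) (f : ('I_n -> X) -> X) : Prop :=
  forall (p : 'I_n -> int) x, (forall i, homog (p i) (x i)) ->
    homog (\sum_i p i + d) (f x).

Definition hom_pred (n : nat) (d : int) : {pred ('I_n -> X) -> X} :=
  fun f => `[< multilin f /\ has_deg d f >].
Arguments hom_pred n d : clear implicits.

Fact hom_submod n d : submod_closed (hom_pred n d).
Proof.
split.
  apply/asboolP; split=> [i x a u v|p x _]; last exact: homog0.
  by rewrite /= scaler0 addr0.
move=> a f g /asboolP[mf df] /asboolP[mg dg]; apply/asboolP; split.
  move=> i x b u v /=; rewrite ![(_ *: f + g) _]/(a *: f _ + g _) mf mg.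
  by rewrite !scalerDr !scalerA [b * a]mulrC addrACA.
by move=> p x hx; apply: homog_lin; [exact: df | exact: dg].
Qed.

HB.instance Definition _ n d :=
  GRing.isSubmodClosed.Build k _ (hom_pred n d) (hom_submod n d).

(* Hom(X^(tensor n), X)_d, as the module of multilinear maps of degree d. *)
Record hom (n : nat) (d : int) := Hom {
  hval :> ('I_n -> X) -> X;
  hvalP : hval \in hom_pred n d }.

HB.instance Definition _ n d := [isSub for @hval n d].
HB.instance Definition _ n d := [Choice of hom n d by <:].
HB.instance Definition _ n d := [SubChoice_isSubLmodule of hom n d by <:].

Lemma hom_multilin n d (f : hom n d) : multilin f.
Proof. by case/asboolP: (hvalP f). Qed.

Lemma hom_deg n d (f : hom n d) : has_deg d f.
Proof. by case/asboolP: (hvalP f). Qed.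

Lemma hom_ext n d (f g : hom n d) : (forall x, f x = g x) -> f = g.
Proof. by move=> H; apply: val_inj; apply: funext. Qed.

Lemma mkhom_subproof n d f : multilin f -> has_deg d f -> f \in hom_pred n d.
Proof. by move=> H1 H2; apply/asboolP. Qed.

Definition xat n (x : 'I_n -> X) (j : nat) : X := oapp x 0 (insub j).

Lemma xat_ord n (x : 'I_n -> X) (j : 'I_n) : xat x j = x j.
Proof. by rewrite /xat valK. Qed.

Lemma xat_lt n (x : 'I_n -> X) j (H : (j < n)%N) : xat x j = x (Ordinal H).
Proof. by rewrite -[j]/(val (Ordinal H)) xat_ord. Qed.

Lemma xat_fun n (F : nat -> X) j : (j < n)%N -> xat (fun i : 'I_n => F i) j = F j.
Proof. by move=> H; rewrite (xat_lt _ H). Qed.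

Lemma xat_shift l (x : 'I_l -> X) n i j : (j < n)%N ->
  xat (fun h : 'I_n => xat x (i + h)) j = xat x (i + j).
Proof. exact: (@xat_fun n (fun h => xat x (i + h))). Qed.

Lemma xat_upd n (x : 'I_n -> X) i u j :
  xat (upd x i u) j = if j == i :> nat then u else xat x j.
Proof.
have [H|H] := ltnP j n; first by rewrite !(xat_lt _ H).
rewrite /xat insubF /=; last by rewrite ltnNge H.
by case: eqP => // E; move: (ltn_ord i); rewrite -E ltnNge H.
Qed.

(* (f o_i g)(x_0, ..., x_(l-1)) =
   (-1)^(|g|(|x_0| + ... + |x_(i-1)|))
     f(x_0, ..., x_(i-1), g(x_i, ..., x_(i+n-1)), x_(i+n), ..., x_(l-1)),
   where n is the arity of g and e its degree. *)
Definition circ_arg (n l : nat) (e : int) (i : nat) (g : ('I_n -> X) -> X)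
    (x : 'I_l -> X) (j : nat) : X :=
  if (j < i)%N then gsgn e (xat x j)
  else if j == i then g (fun h => xat x (i + h))
  else xat x (j + n).-1.

Definition circ_fun (m n l : nat) (e : int) (f : ('I_m -> X) -> X) (i : 'I_m)
    (g : ('I_n -> X) -> X) (x : 'I_l -> X) : X :=
  f (fun j => circ_arg e i g x j).

Lemma circ_multilin m n l e f (i : 'I_m) g : (m + n = l.+1)%N ->
  multilin f -> multilin g -> multilin (@circ_fun m n l e f i g).
Proof.
move=> E mf mg h x a u v; rewrite /circ_fun.
have [hi|ih] := ltnP h i.
  have Hm : (h < m)%N by apply: ltn_trans hi (ltn_ord i).
  have R w : (fun j : 'I_m => circ_arg e i g (upd x h w) j) =
             upd (fun j : 'I_m => circ_arg e i g x j) (Ordinal Hm) (gsgn e w).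
    apply: funext => j; rewrite /circ_arg /upd -val_eqE /= !xat_upd.
    case: eqP => [->|/eqP jh]; first by rewrite hi ?eqxx.
    case: ltnP => // ij; case: eqP => [_|/eqP ji].
      congr g; apply: funext => o; rewrite xat_upd.
      by have -> : (i + o == h)%N = false by lia.
    by have -> : ((j + n).-1 == h)%N = false by lia.
  by rewrite !R gsgn_lin mf.
have [hn|nh] := ltnP h (i + n).
  have Hn : (h - i < n)%N by lia.
  have R w : (fun j : 'I_m => circ_arg e i g (upd x h w) j) =
             upd (fun j : 'I_m => circ_arg e i g x j) i
               (g (upd (fun o : 'I_n => xat x (i + o)) (Ordinal Hn) w)).
    apply: funext => j; rewrite /circ_arg /upd -val_eqE /= !xat_upd.
    case: ltnP => ij.
      have -> : (j == h :> nat) = false by lia.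
      by have -> : (j == i :> nat) = false by lia.
    case: eqP => [_|/eqP ji].
      congr g; apply: funext => o; rewrite xat_upd -val_eqE /=.
      by have -> : (i + o == h)%N = (o == h - i :> nat)%N by lia.
    by have -> : ((j + n).-1 == h)%N = false by lia.
  by rewrite !R mg mf.
have Hm : (h.+1 - n < m)%N by have := ltn_ord h; lia.
have R w : (fun j : 'I_m => circ_arg e i g (upd x h w) j) =
           upd (fun j : 'I_m => circ_arg e i g x j) (Ordinal Hm) w.
  apply: funext => j; rewrite /circ_arg /upd -val_eqE /= !xat_upd.
  case: ltnP => ij.
    have -> : (j == h :> nat) = false by lia.
    by have -> : (j == h.+1 - n :> nat)%N = false by lia.
  case: eqP => [->|/eqP ji].
    rewrite (_ : (i == h.+1 - n :> nat)%N = false); last by lia.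
    congr g; apply: funext => o; rewrite xat_upd.
    by have -> : (i + o == h)%N = false by have := ltn_ord o; lia.
  by have -> : ((j + n).-1 == h)%N = (j == h.+1 - n :> nat)%N by lia.
by rewrite !R mf.
Qed.

Lemma sum_block (m n l : nat) (i : 'I_m) (F : nat -> int) c : (m + n = l.+1)%N ->
  \sum_(j < m) (if (j < i)%N then F j
                else if j == i :> nat then \sum_(h < n) F (i + h)%N + c
                else F (j + n).-1) = \sum_(j < l) F j + c.
Proof.
move=> E; set G := fun j : nat => if (j < i)%N then F j else
  if j == i :> nat then \sum_(h < n) F (i + h)%N + c else F (j + n).-1.
have im := ltn_ord i.
rewrite -(big_mkord xpredT G) -(big_mkord xpredT F).
have inl : (i + n <= l)%N by lia.
rewrite (@big_cat_nat _ _ _ i) ?(ltnW im) //= (@big_ltn _ _ _ i) //=.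
rewrite [in RHS](@big_cat_nat _ _ _ i 0 l) //=; last by lia.
rewrite [X in _ = _ + X + _](@big_cat_nat _ _ _ (i + n) i l) ?leq_addr //=.
have -> : \sum_(0 <= j < i) G j = \sum_(0 <= j < i) F j.
  by apply: eq_big_nat => j /andP[_ ji]; rewrite /G ji.
have -> : \sum_(i.+1 <= j < m) G j = \sum_(i + n <= j < l) F j.
  rewrite -[i.+1]add0n -[(i + n)%N]add0n !big_addn.
  have -> : (m - i.+1 = l - (i + n))%N by lia.
  apply: eq_bigr => j _; rewrite /G.
  have -> : (j + i.+1 < i)%N = false by lia.
  have -> : (j + i.+1 == i)%N = false by lia.
  by congr F; lia.
have -> : \sum_(i <= j < i + n) F j = \sum_(h < n) F (i + h)%N.
  rewrite -{1}[(i : nat)]add0n big_addn addKn big_mkord.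
  by apply: eq_bigr => h _; rewrite addnC.
rewrite /G ltnn eqxx -!addrA; congr (_ + (_ + _)).
by rewrite addrC.
Qed.

Lemma circ_deg m n l p q r (f : ('I_m -> X) -> X) (i : 'I_m) g :
  (m + n = l.+1)%N -> p + q = r ->
  has_deg p f -> has_deg q g -> has_deg r (@circ_fun m n l q f i g).
Proof.
move=> E <- df dg d x hx; pose F j := oapp d 0 (insub j).
have hF j : homog (F j) (xat x j).
  by rewrite /F /xat; case: insubP => [o _ _|_] /=; [exact: hx | exact: homog0].
have -> : \sum_(j < l) d j = \sum_(j < l) F j.
  by apply: eq_bigr => j _; rewrite /F valK.
rewrite [p + q]addrC addrA -(sum_block i F q E); apply: df => j.
rewrite /circ_arg; case: ltnP => _; first exact: homog_gsgn.
by case: eqP => // _; apply: dg => h.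
Qed.

Definition hom_circ m n l p q r (E : (m + n = l.+1)%N) (D : p + q = r)
    (f : hom m p) (i : 'I_m) (g : hom n q) : hom l r :=
  Hom (mkhom_subproof
    (circ_multilin q i E (@hom_multilin _ _ f) (@hom_multilin _ _ g))
    (circ_deg i E D (@hom_deg _ _ f) (@hom_deg _ _ g))).

Fact hom1_multilin : multilin (fun x : 'I_1 -> X => x ord0).
Proof. by move=> i x a u v; rewrite /upd (ord1 i). Qed.

Fact hom1_deg : has_deg 0 (fun x : 'I_1 -> X => x ord0).
Proof. by move=> p x hx; rewrite big_ord1 addr0; exact: hx. Qed.

Definition hom1 : hom 1 0 := Hom (mkhom_subproof hom1_multilin hom1_deg).

Fact hom_circ_linl m n l p q r (E : (m + n = l.+1)%N) (D : p + q = r)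
    (a : k) (f f' : hom m p) i (g : hom n q) :
  hom_circ E D (a *: f + f') i g = a *: hom_circ E D f i g + hom_circ E D f' i g.
Proof. by apply: hom_ext => x. Qed.

Lemma updE n (x : 'I_n -> X) i : upd x i (x i) = x.
Proof. by apply: funext => j; rewrite /upd; case: eqP => [->|]. Qed.

Fact hom_circ_linr m n l p q r (E : (m + n = l.+1)%N) (D : p + q = r)
    (a : k) (f : hom m p) i (g g' : hom n q) :
  hom_circ E D f i (a *: g + g') = a *: hom_circ E D f i g + hom_circ E D f i g'.
Proof.
apply: hom_ext => x.
change (circ_fun q f i (a *: g + g') x =
  a *: circ_fun q f i g x + circ_fun q f i g' x); rewrite /circ_fun.
have R (h : ('I_n -> X) -> X) : (fun j : 'I_m => circ_arg q i h x j) =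
    upd (fun j : 'I_m => circ_arg q i g x j) i (h (fun o => xat x (i + o))).
  apply: funext => j; rewrite /upd /circ_arg -val_eqE /=.
  case: ltnP => ji; last by case: eqP.
  by have -> : (j == i :> nat) = false by lia.
rewrite (R (hval (a *: g + g'))) (R (hval g')) [X in a *: f X]R.
exact: hom_multilin.
Qed.

Fact hom_circ1l n q (E : (1 + n = n.+1)%N) (D : 0 + q = q) i (g : hom n q) :
  hom_circ E D hom1 i g = g.
Proof.
apply: hom_ext => x /=; rewrite /circ_fun /circ_arg (ord1 i) /=.
by congr (hval g _); apply: funext => j; rewrite add0n xat_ord.
Qed.

Fact hom_circ1r m p (E : (m + 1 = m.+1)%N) (D : p + 0 = p) (f : hom m p) i :
  hom_circ E D f i hom1 = f.
Proof.
apply: hom_ext => x /=; rewrite /circ_fun; congr (hval f _); apply: funext => j.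
rewrite /circ_arg; case: ltnP => _; first by rewrite gsgn0 xat_ord.
by case: eqP => [ji|_] /=; rewrite ?addn0 -?ji ?addn1 xat_ord.
Qed.

Fact hom_circA m n o l1 l2 l p q r d1 d2 d
    (E1 : (m + n = l1.+1)%N) (D1 : p + q = d1)
    (E2 : (n + o = l2.+1)%N) (D2 : q + r = d2)
    (E3 : (l1 + o = l.+1)%N) (D3 : d1 + r = d)
    (E4 : (m + l2 = l.+1)%N) (D4 : p + d2 = d)
    (x : hom m p) (y : hom n q) (z : hom o r)
    (i : 'I_m) (j : 'I_n) (h : 'I_l1) : h = (i + j)%N :> nat ->
  hom_circ E3 D3 (hom_circ E1 D1 x i y) h z =
  hom_circ E4 D4 x i (hom_circ E2 D2 y j z).
Proof.
move=> hij; apply: hom_ext => t /=; rewrite /circ_fun; congr (hval x _).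
have [im jn hl] := And3 (ltn_ord i) (ltn_ord j) (ltn_ord h).
apply: funext => s; have sm := ltn_ord s.
rewrite {1 3}/circ_arg; case: ltnP => si.
  rewrite xat_fun; last by lia.
  rewrite /circ_arg; have -> : (s < h)%N by lia.
  by rewrite gsgnD D2.
case: eqP => [_|/eqP si'].
  congr (hval y _); apply: funext => b; have bn := ltn_ord b.
  rewrite xat_fun; last by lia.
  rewrite /circ_arg hij ltn_add2l eqn_add2l; case: ltnP => bj.
    by rewrite xat_shift //; lia.
  case: eqP => [_|/eqP bj'].
    congr (hval z _); apply: funext => c; have cn := ltn_ord c.
    by rewrite xat_shift ?addnA //; lia.
  rewrite xat_shift; last by lia.
  by congr xat; lia.
rewrite xat_fun; last by lia.
rewrite /circ_arg.
have -> : ((s + n).-1 < h)%N = false by lia.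
have -> : ((s + n).-1 == h :> nat)%N = false by lia.
by congr xat; lia.
Qed.

Lemma hom_gpr_ext n (f g : ('I_n -> X) -> X) : multilin f -> multilin g ->
  (forall (p : 'I_n -> int) x, (forall i, homog (p i) (x i)) -> f x = g x) ->
  f = g.
Proof.
move=> mf mg H; apply: funext.
suff : forall c, (c <= n)%N -> forall (x : 'I_n -> X),
    (forall i : 'I_n, (c <= i)%N -> exists p, homog p (x i)) -> f x = g x.
  move=> /(_ n (leqnn n)) K x; apply: K => i; by rewrite leqNgt ltn_ord.
elim=> [_|c IH cn] x hx.
  pose p i := xget 0 [set p | homog p (x i)].
  apply: (H p) => i; have [q hq] := hx i isT.
  by rewrite /p; case: xgetP => [q' -> //|/(_ q)].
pose i0 := Ordinal cn.
have f0 (h : ('I_n -> X) -> X) : multilin h -> h (upd x i0 0) = 0.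
  by move=> mh; have := mh i0 x (-1) 0 0; rewrite scaler0 addr0 scaleN1r addNr.
have [s us hs] := gpr_supp (x i0).
rewrite -(updE x i0) (gpr_sum (x i0)) (fsbig_supp_seq us hs).
elim: s {us hs} => [|q s IHs]; first by rewrite big_nil !f0.
rewrite big_cons -[gpr X q _]scale1r mf mg IHs; congr (_ *: _ + _).
apply: IH (ltnW cn) _ _ => i ci; rewrite /upd; case: eqP => [_|/eqP ii].
  by exists q; exact: homog_gpr.
by apply: hx; rewrite ltn_neqAle ci andbT eq_sym -val_eqE in ii *.
Qed.

Lemma hom_gsgn n d e (f : hom n d) (x : 'I_n -> X) :
  gsgn e (f x) = ksign k (d * e) *: f (fun i => gsgn e (x i)).
Proof.
have mf := @hom_multilin _ _ f.
have upd_gsgn i u (y : 'I_n -> X) : (fun j => gsgn e (upd y i u j)) =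
    upd (fun j => gsgn e (y j)) i (gsgn e u).
  by apply: funext => j; rewrite /upd; case: eqP.
suff /(congr1 (fun h => h x)) : (fun y => gsgn e (f y)) =
  (fun y => ksign k (d * e) *: f (fun i => gsgn e (y i))) by [].
apply: hom_gpr_ext.
- by move=> i y a u v; rewrite mf gsgn_lin.
- move=> i y a u v; have U w := upd_gsgn i w y.
  rewrite (U (a *: u + v)) (U u) (U v) (gsgn_lin e a u v).
  rewrite (mf i (fun j => gsgn e (y j)) a (gsgn e u) (gsgn e v)).
  rewrite scalerDr !scalerA.
  by congr (_ *: _ + _); rewrite mulrC.
move=> p y hy; rewrite (gsgn_homog e (hom_deg f hy)).
have scale_mult (c : 'I_n -> k) (s : seq 'I_n) : uniq s ->
    f (fun i => if i \in s then c i *: y i else y i) = (\prod_(i <- s) c i) *: f y.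
  elim: s => [_|i s IHs /= /andP[si us]]; first by rewrite big_nil scale1r.
  rewrite big_cons -scalerA -(IHs us).
  set z := (fun j => if j \in s then _ else _).
  have -> : (fun j => if j \in i :: s then c j *: y j else y j) =
            upd z i (c i *: y i + 0).
    apply: funext => j; rewrite /upd /z inE addr0.
    by case: eqP => [->|].
  have z0 : f (upd z i 0) = 0.
    by have := mf i z (-1) 0 0; rewrite scaler0 addr0 scaleN1r addNr.
  rewrite mf z0 addr0; congr (_ *: f _); rewrite -[RHS](updE z i).
  by congr upd; rewrite /z (negbTE si).
have -> : (fun i => gsgn e (y i)) =
    (fun i => if i \in enum 'I_n then ksign k (e * p i) *: y i else y i).
  by apply: funext => i; rewrite mem_enum (gsgn_homog e (hy i)).
rewrite (scale_mult (fun i => ksign k (e * p i))) ?enum_uniq // scalerA.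
congr (_ *: _); rewrite big_enum /= -[in RHS]mulrC mulrDr ksignD [e * d]mulrC.
congr (_ * _); rewrite mulr_sumr.
by apply: (big_morph (ksign k)) => [a b|]; rewrite ?ksignD ?ksign0.
Qed.

Fact hom_circC m n o l1 l2 l p q r d1 d2 d
    (E1 : (m + n = l1.+1)%N) (D1 : p + q = d1)
    (E2 : (m + o = l2.+1)%N) (D2 : p + r = d2)
    (E3 : (l1 + o = l.+1)%N) (D3 : d1 + r = d)
    (E4 : (l2 + n = l.+1)%N) (D4 : d2 + q = d)
    (x : hom m p) (y : hom n q) (z : hom o r)
    (i j : 'I_m) (i' : 'I_l2) (j' : 'I_l1) : (i < j)%N ->
    i' = i :> nat -> j'.+1 = (j + n)%N ->
  hom_circ E3 D3 (hom_circ E1 D1 x i y) j' z =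
  ksign k (q * r) *: hom_circ E4 D4 (hom_circ E2 D2 x j z) i' y.
Proof.
move=> ij ii jj; apply: hom_ext => t.
have [im jm] := (ltn_ord i, ltn_ord j).
have [im' jm'] := (ltn_ord i', ltn_ord j').
change (circ_fun r (circ_fun q x i y) j' z t =
  ksign k (q * r) *: circ_fun q (circ_fun r x j z) i' y t).
have mx := @hom_multilin _ _ x.
pose w s : X := circ_arg r j z (fun b : 'I_l2 => circ_arg q i' y t b) s.
have ksc c u (v : 'I_m -> X) : x (upd v i (c *: u)) = c *: x (upd v i u).
  have v0 : x (upd v i 0) = 0.
    by have := mx i v (-1) 0 0; rewrite scaler0 addr0 scaleN1r addNr.
  by rewrite -[c *: u]addr0 mx v0 addr0.
rewrite /circ_fun.
transitivity (x (upd (fun s : 'I_m => w s) i (ksign k (q * r) *: w i))); last first.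
  by rewrite ksc; congr (_ *: hval x _); exact: (updE (fun s : 'I_m => w s) i).
congr (hval x _); apply: funext => s; have sm := ltn_ord s.
rewrite /upd /w -val_eqE /=.
have [si|/eqP si] := eqVneq (val s) (val i).
  rewrite [LHS]/circ_arg si ltnn eqxx [in RHS]/circ_arg ij.
  rewrite [X in gsgn r X](@xat_fun l2 (circ_arg q i' y t)); last by lia.
  rewrite /circ_arg ii ltnn eqxx hom_gsgn scalerA ksign_sq scale1r.
  congr (hval y _); apply: funext => b; have bn := ltn_ord b.
  rewrite (@xat_fun l1 (circ_arg r j' z t)); last by lia.
  by rewrite /circ_arg (_ : (i + b < j')%N) //; lia.
rewrite [LHS]/circ_arg; case: ltnP => s1.
  rewrite (@xat_fun l1 (circ_arg r j' z t)); last by lia.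
  rewrite [RHS]/circ_arg (_ : (s < j)%N); last by lia.
  rewrite (@xat_fun l2 (circ_arg q i' y t)); last by lia.
  rewrite /circ_arg (_ : (s < j')%N); last by lia.
  rewrite (_ : (s < i')%N); last by lia.
  by rewrite !gsgnD addrC.
have -> : (s == i :> nat) = false by apply/negbTE/eqP.
have is' : (i < s)%N by rewrite ltn_neqAle s1 andbT eq_sym; apply/eqP.
rewrite (@xat_fun l1 (circ_arg r j' z t)); last by lia.
rewrite [RHS]/circ_arg; case: ltnP => s2.
  rewrite (@xat_fun l2 (circ_arg q i' y t)); last by lia.
  rewrite /circ_arg (_ : ((s + n).-1 < j')%N); last by lia.
  have -> : (s < i')%N = false by lia.
  by have -> : (s == i' :> nat) = false by lia.
rewrite [LHS]/circ_arg; have -> : ((s + n).-1 < j')%N = false by lia.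
case: eqP => s3.
  rewrite (_ : (s == j :> nat)); last by lia.
  congr (hval z _); apply: funext => c; have cn := ltn_ord c.
  rewrite (@xat_fun l2 (circ_arg q i' y t)); last by lia.
  rewrite /circ_arg; have -> : (j + c < i')%N = false by lia.
  have -> : (j + c == i')%N = false by lia.
  by congr xat; lia.
have -> : (s == j :> nat) = false by lia.
rewrite (@xat_fun l2 (circ_arg q i' y t)); last by lia.
rewrite /circ_arg; have -> : ((s + o).-1 < i')%N = false by lia.
have -> : ((s + o).-1 == i' :> nat)%N = false by lia.
by congr xat; lia.
Qed.

Definition grEnd : grOperad k :=
  @GrOperad k (fun n d => hom n d) hom1 hom_circ hom_circ_linl hom_circ_linr
    hom_circ1l hom_circ1r hom_circA hom_circC.

(* X has the trivial differential, hence so does Hom(X^(tensor n), X). *)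
Definition zero_diff n p r (_ : p = r + 1) : {linear grEnd n p -> grEnd n r} := \0.

Fact zero_diffK n p r s (Hp : p = r + 1) (Hr : r = s + 1) (x : grEnd n p) :
  zero_diff n Hr (zero_diff n Hp x) = 0.
Proof. by []. Qed.

Fact zero_diff_circ m n l p q r p' q' r' (E : (m + n = l.+1)%N) (D : p + q = r)
    (Hp : p = p' + 1) (Hq : q = q' + 1) (Hr : r = r' + 1)
    (Dp : p' + q = r') (Dq : p + q' = r') (x : grEnd m p) i (y : grEnd n q) :
  zero_diff l Hr (circ E D x i y) =
    circ E Dp (zero_diff m Hp x) i y + ksign k p *: circ E Dq x i (zero_diff n Hq y).
Proof.
have Z a b c (H : b = c + 1) (z : grEnd a b) : zero_diff a H z = 0 by [].
by rewrite !Z circ0l circ0r scaler0 addr0.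
Qed.

Definition EndOp : dgOperad k := DgOperad zero_diffK zero_diff_circ.

End EndomorphismOperad.

Section AInfinity.
Variable k : comPzRingType.

(* x{y} = sum_i x o_i y *)
Definition brace (P : grOperad k) m n l p q r (E : (m + n = l.+1)%N)
    (D : p + q = r) (x : P m p) (y : P n q) : P l r :=
  \sum_(i < m) circ E D x i y.

Fact brace_arity n (p : 'I_n.+2) : (p + (n.+1 - p) = n.+1)%N.
Proof. by rewrite subnKC // -ltnS. Qed.

Fact brace_deg : (-1) + (-1) = -2 :> int. Proof. by []. Qed.
Fact diff_deg : -1 = -2 + 1 :> int. Proof. by []. Qed.

(* The DG-operad A_infinity, characterized by the universal property of the
   underlying free graded operad.  The values of mu (and of a below) at
   arities 0 and 1 are irrelevant. *)
Record Ainfty := MkAinfty {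
  Aop :> dgOperad k;
  mu : forall n, Aop n (-1);
  mu_diff : forall n, (2 <= n)%N ->
    diff Aop n diff_deg (mu n) =
      \sum_(p < n.+2 | (2 <= p)%N && (2 <= n.+1 - p)%N)
        brace (brace_arity p) brace_deg (mu p) (mu (n.+1 - p));
  mu_free : forall (P : grOperad k) (a : forall n, P n (-1)),
    (exists f : grHom Aop P, forall n, (2 <= n)%N -> f n (-1) (mu n) = a n) /\
    (forall f g : grHom Aop P,
       (forall n, (2 <= n)%N -> f n (-1) (mu n) = a n) ->
       (forall n, (2 <= n)%N -> g n (-1) (mu n) = a n) ->
       forall n p x, f n p x = g n p x) }.

(* Membership in A_m, the sub-DG-operad of A_infinity generated by
   mu_2, ..., mu_m. *)
Inductive Agen (A : Ainfty) (m : nat) : forall n p, A n p -> Prop :=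
| Agen_mu i : (2 <= i <= m)%N -> Agen m (mu A i)
| Agen_one : Agen m (op1 A)
| Agen_0 n p : Agen m (0 : A n p)
| Agen_lin n p (a : k) (x y : A n p) :
    Agen m x -> Agen m y -> Agen m (a *: x + y)
| Agen_circ n o l p q r (E : (n + o = l.+1)%N) (D : p + q = r)
    (x : A n p) i (y : A o q) :
    Agen m x -> Agen m y -> Agen m (circ E D x i y)
| Agen_diff n p r (H : p = r + 1) (x : A n p) :
    Agen m x -> Agen m (diff A n H x).

Section Truncation.
Variables (A : Ainfty) (m : nat).

Definition Apred (n : nat) (p : int) : {pred A n p} := fun x => `[< Agen m x >].
Arguments Apred n p : clear implicits.

Fact Apred_submod n p : submod_closed (Apred n p).
Proof.
split; first exact/asboolP/Agen_0.
by move=> a x y /asboolP hx /asboolP hy; apply/asboolP/Agen_lin.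
Qed.

HB.instance Definition _ n p :=
  GRing.isSubmodClosed.Build k _ (Apred n p) (Apred_submod n p).

Record Asub (n : nat) (p : int) := MkAsub {
  aval : A n p;
  avalP : aval \in Apred n p }.

HB.instance Definition _ n p := [isSub for @aval n p].
HB.instance Definition _ n p := [Choice of Asub n p by <:].
HB.instance Definition _ n p := [SubChoice_isSubLmodule of Asub n p by <:].

Definition mkAsub n p (x : A n p) (H : Agen m x) : Asub n p := MkAsub (asboolT H).

Lemma Asub_gen n p (x : Asub n p) : Agen m (aval x).
Proof. exact/asboolP/avalP. Qed.

Definition Asub1 : Asub 1 0 := mkAsub (Agen_one A m).

Definition Asub_mu i (H : (2 <= i <= m)%N) : Asub i (-1) := mkAsub (Agen_mu A H).

Definition Asub_circ n o l p q r (E : (n + o = l.+1)%N) (D : p + q = r)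
    (x : Asub n p) i (y : Asub o q) : Asub l r :=
  mkAsub (Agen_circ E D i (Asub_gen x) (Asub_gen y)).

Definition Asub_diff n p r (H : p = r + 1) (x : Asub n p) : Asub n r :=
  mkAsub (Agen_diff H (Asub_gen x)).

Fact Asub_diff_linear n p r (H : p = r + 1) : linear (@Asub_diff n p r H).
Proof. by move=> a x y; apply: val_inj; rewrite /= linearP. Qed.

HB.instance Definition _ n p r (H : p = r + 1) :=
  GRing.isLinear.Build k _ _ _ (@Asub_diff n p r H) (Asub_diff_linear H).

Definition grAtrunc : grOperad k.
Proof.
refine (@GrOperad k (fun n p => Asub n p) Asub1 Asub_circ _ _ _ _ _ _).
- by move=> *; apply: val_inj; exact: circ_linl.
- by move=> *; apply: val_inj; exact: circ_linr.
- by move=> *; apply: val_inj; exact: circ1l.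
- by move=> *; apply: val_inj; exact: circ1r.
- by move=> *; apply: val_inj; exact: circA.
- by move=> *; apply: val_inj; exact: circC.
Defined.

(* The DG-operad A_m *)
Definition Atrunc : dgOperad k.
Proof.
refine (@DgOperad k grAtrunc (fun n p r H => @Asub_diff n p r H) _ _).
- by move=> *; apply: val_inj; exact: diffK.
- by move=> *; apply: val_inj; exact: diff_circ.
Defined.

Fact aval_linear n p : linear (@aval n p).
Proof. by []. Qed.

HB.instance Definition _ n p :=
  GRing.isLinear.Build k _ _ _ (@aval n p) (@aval_linear n p).

Definition grAtrunc_incl : grHom grAtrunc A :=
  @GrHom k grAtrunc A (fun n p => @aval n p) erefl
    (fun _ _ _ _ _ _ _ _ _ _ _ => erefl).

Definition Atrunc_incl : dgHom Atrunc A :=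
  @DgHom k Atrunc A grAtrunc_incl (fun _ _ _ _ _ => erefl).

End Truncation.

Section Inclusion.
Variables (A : Ainfty) (m m' : nat) (mm' : (m <= m')%N).

Lemma Agen_le n p (x : A n p) : Agen m x -> Agen m' x.
Proof.
elim=> *; [apply: Agen_mu; lia|exact: Agen_one|exact: Agen_0|exact: Agen_lin|
  exact: Agen_circ|exact: Agen_diff].
Qed.

Definition Aincl_fun n p (x : Asub A m n p) : Asub A m' n p :=
  mkAsub (Agen_le (Asub_gen x)).

Fact Aincl_linear n p : linear (@Aincl_fun n p).
Proof. by move=> a x y; apply: val_inj. Qed.

HB.instance Definition _ n p :=
  GRing.isLinear.Build k _ _ _ (@Aincl_fun n p) (@Aincl_linear n p).

Definition grAincl : grHom (grAtrunc A m) (grAtrunc A m').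
Proof.
by refine (@GrHom k (grAtrunc A m) (grAtrunc A m') (fun n p => @Aincl_fun n p) _ _);
  move=> *; apply: val_inj.
Defined.

Definition Aincl : dgHom (Atrunc A m) (Atrunc A m').
Proof.
by refine (@DgHom k (Atrunc A m) (Atrunc A m') grAincl _);
  move=> *; apply: val_inj.
Defined.

End Inclusion.
End AInfinity.

Section SimplicialSets.

Record dmap (m n : nat) := Dmap {
  dfun :> 'I_m.+1 -> 'I_n.+1;
  dmono : {homo dfun : i j / (i <= j)%N} }.

Definition did n : dmap n n := @Dmap n n id (fun _ _ => id).

Definition dcomp l m n (t : dmap m n) (u : dmap l m) : dmap l n :=
  @Dmap l n (t \o u) (fun i j h => dmono t (dmono u h)).

Fact dface_mono n (i : 'I_n.+2) : {homo lift i : j h / (j <= h)%N}.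
Proof. by move=> j h; rewrite /= leq_bump2. Qed.

Definition dface n (i : 'I_n.+2) : dmap n n.+1 := @Dmap n n.+1 (lift i) (dface_mono i).

Record sset := SSet {
  ssimp :> nat -> Type;
  sact : forall m n, dmap m n -> ssimp n -> ssimp m;
  sact_id : forall n (x : ssimp n), sact (did n) x = x;
  sact_comp : forall l m n (t : dmap m n) (u : dmap l m) (x : ssimp n),
    sact (dcomp t u) x = sact u (sact t x) }.

Record ssetHom (S T : sset) := SSetHom {
  ss_map :> forall n, S n -> T n;
  ss_map_act : forall m n (t : dmap m n) (x : S n),
    ss_map (sact t x) = sact t (ss_map x) }.
#[global] Arguments ss_map {S T} s n x.

Definition edge (S : sset) (x y : S 0%N) : Prop :=
  exists e : S 1%N, sact (dface (ord_max : 'I_2)) e = x /\ sact (dface (ord0 : 'I_2)) e = y.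

Definition connected_by (S : sset) : S 0%N -> S 0%N -> Prop :=
  clos_refl_sym_trans (S 0%N) (@edge S).

Definition pi0 (S : sset) : Type :=
  {C : set (S 0%N) | exists x, C = [set y | connected_by x y]}.

Definition pi0_class (S : sset) (x : S 0%N) : pi0 S :=
  exist _ [set y | connected_by x y] (ex_intro _ x erefl).

Lemma ss_map_connected (S T : sset) (f : ssetHom S T) (x y : S 0%N) :
  connected_by x y -> connected_by (f 0%N x) (f 0%N y).
Proof.
elim=> {x y} [x y [e [<- <-]]|x|x y _ h|x y z _ h1 _ h2].
- by apply: rst_step; exists (f 1%N e); rewrite !ss_map_act.
- exact: rst_refl.
- exact: rst_sym.
- exact: rst_trans h1 h2.
Qed.

Fact pi0_map_subproof (S T : sset) (f : ssetHom S T) (C : pi0 S) :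
  exists y, [set z | exists2 x, sval C x & connected_by (f 0%N x) z] =
            [set z | connected_by y z].
Proof.
case: C => C /= [x ->]; exists (f 0%N x); apply/seteqP; split=> z /=.
  by move=> [y /(ss_map_connected f) xy yz]; exact: rst_trans xy yz.
by move=> xz; exists x => //; exact: rst_refl.
Qed.

Definition pi0_map (S T : sset) (f : ssetHom S T) (C : pi0 S) : pi0 T :=
  exist _ _ (pi0_map_subproof f C).

Lemma pi0_mapE (S T : sset) (f : ssetHom S T) (x : S 0%N) :
  pi0_map f (pi0_class x) = pi0_class (f 0%N x).
Proof.
apply: eq_exist => /=; apply/seteqP; split=> z /=.
  by move=> [y /(ss_map_connected f) xy yz]; exact: rst_trans xy yz.
by move=> xz; exists x => //; exact: rst_refl.
Qed.

(* The nonnegative part X_0 <- X_1 <- ... of a tower of pointed simplicial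
   sets with X_n = * for n < 0. *)
Record tower := Tower {
  tw :> nat -> sset;
  tw_res : forall m n, (m <= n)%N -> ssetHom (tw n) (tw m);
  tw_res_id : forall n (h : (n <= n)%N) d (x : tw n d), tw_res h d x = x;
  tw_res_comp : forall l m n (h : (l <= m)%N) (h' : (m <= n)%N) (h'' : (l <= n)%N)
    d (x : tw n d), tw_res h'' d x = tw_res h d (tw_res h' d x);
  tw_pt : forall n, tw n 0%N;
  tw_res_pt : forall m n (h : (m <= n)%N), tw_res h 0%N (tw_pt n) = tw_pt m }.
#[global] Arguments tw_res t {m n} h.
#[global] Arguments tw_pt t n.

(* The Bousfield-Kan term E_r^{00}, r >= 1.  As X_n = * for n < 0, the homotopy
   fiber X_{0,-1} is X_0 and the group acting on the lifting classes is
   trivial, so E_r^{00} = Im[pi_0 X_(r-1) -> pi_0 X_0]. *)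
Definition BK_E00 (T : tower) (r : nat) : set (pi0 (T 0%N)) :=
  range (pi0_map (tw_res T (leq0n r.-1))).
#[global] Arguments BK_E00 T r : clear implicits.

Definition BK_base (T : tower) : pi0 (T 0%N) := pi0_class (tw_pt T 0).

Lemma BK_base_in (T : tower) (r : nat) : BK_E00 T r (BK_base T).
Proof.
by exists (pi0_class (tw_pt T r.-1)) => //; rewrite pi0_mapE tw_res_pt.
Qed.

End SimplicialSets.

Section MappingSpaces.
Variable k : comPzRingType.

Definition cycle (P : dgOperad k) n p (x : P n p) : Prop :=
  forall r (H : p = r + 1), diff P n H x = 0.

Definition boundary (P : dgOperad k) n p (x : P n p) : Prop :=
  exists q (H : q = p + 1) (y : P n q), diff P n H y = x.

(* f is injective and surjective on homology. *)
Definition quasi_iso (P Q : dgOperad k) (f : dgHom P Q) : Prop :=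
  forall n p,
    (forall x : P n p, cycle x -> boundary (f n p x) -> boundary x) /\
    (forall y : Q n p, cycle y -> exists2 x : P n p, cycle x & boundary (f n p x - y)).

Record sdgOperad := SDgOperad {
  so :> nat -> dgOperad k;
  so_act : forall m n, dmap m n -> dgHom (so n) (so m);
  so_act_id : forall n a p (x : so n a p), so_act (did n) a p x = x;
  so_act_comp : forall l m n (t : dmap m n) (u : dmap l m) a p (x : so n a p),
    so_act (dcomp t u) a p x = so_act u a p (so_act t a p x) }.

Definition dsurj m n (t : dmap m n) : Prop := forall j, exists i, t i = j.

(* An element of the n-th matching object is a compatible family indexed by the
   simplices of the boundary of Delta^n, i.e. by the non-surjective maps
   t : [m] -> [n]; the values of x at surjective t are irrelevant. *)
Definition reedy_fibrant (O : sdgOperad) : Prop :=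
  forall n a p (x : forall m, dmap m n -> O m a p),
    (forall l m (t : dmap m n) (u : dmap l m), ~ dsurj t ->
       so_act O u a p (x m t) = x l (dcomp t u)) ->
    exists y : O n a p, forall m (t : dmap m n), ~ dsurj t ->
      so_act O t a p y = x m t.

(* A simplicial resolution of Q: a Reedy fibrant simplicial DG-operad weakly
   equivalent to the constant one at Q. *)
Record resolution (Q : dgOperad k) := Resolution {
  res_op :> sdgOperad;
  res_aug : forall n, dgHom Q (res_op n);
  res_aug_act : forall m n (t : dmap m n) a p (x : Q a p),
    so_act res_op t a p (res_aug n a p x) = res_aug m a p x;
  res_aug_qi : forall n, quasi_iso (res_aug n);
  res_fib : reedy_fibrant res_op }.

(* Map_dgOp(P, Q), for P cofibrant, computed with a simplicial resolution of
   Q: its n-simplices are the DG-operad maps from P to the n-th term. *)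
Definition Map (P : dgOperad k) (O : sdgOperad) : sset.
Proof.
refine (@SSet (fun n => dgHom P (O n)) (fun m n t f => dgComp (so_act O t) f) _ _).
- by move=> n f; apply: dgHom_ext => a p x; exact: so_act_id.
- by move=> l m n t u f; apply: dgHom_ext => a p x; exact: so_act_comp.
Defined.

Definition Map_precomp (P P' : dgOperad k) (O : sdgOperad) (g : dgHom P P') :
  ssetHom (Map P' O) (Map P O).
Proof.
refine (@SSetHom (Map P' O) (Map P O) (fun n f => dgComp f g) _).
by move=> m n t f; apply: dgHom_ext.
Defined.

(* The vertex of Map_dgOp(P, Q) given by a DG-operad map f : P -> Q. *)
Definition Map_vertex (P Q : dgOperad k) (R : resolution Q) (f : dgHom P Q) :
  Map P R 0%N := dgComp (res_aug R 0%N) f.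

Section Tower.
Variables (A : Ainfty k) (Q : dgOperad k) (R : resolution Q) (phi : dgHom A Q).

Definition At_space (n : nat) : sset := Map (Atrunc A n.+2) R.

Definition At_res m n (h : (m <= n)%N) : ssetHom (At_space n) (At_space m) :=
  Map_precomp R (Aincl A (h : (m.+2 <= n.+2)%N)).

Definition At_pt (n : nat) : At_space n 0%N :=
  Map_vertex R (dgComp phi (Atrunc_incl A n.+2)).

Fact At_res_id n (h : (n <= n)%N) d (f : At_space n d) : At_res h d f = f.
Proof. apply: dgHom_ext => a p x; congr (dg_map f a p _); exact: val_inj. Qed.

Fact At_res_comp l m n (h : (l <= m)%N) (h' : (m <= n)%N) (h'' : (l <= n)%N)
  d (f : At_space n d) : At_res h'' d f = At_res h d (At_res h' d f).
Proof. apply: dgHom_ext => a p x; congr (dg_map f a p _); exact: val_inj. Qed.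

Fact At_res_pt m n (h : (m <= n)%N) : At_res h 0%N (At_pt n) = At_pt m.
Proof. exact: dgHom_ext. Qed.

(* X_n = Map_dgOp(A_(n+2), Q), based at the restrictions of phi. *)
Definition Ainf_tower : tower := Tower At_res_id At_res_comp At_res_pt.

End Tower.
End MappingSpaces.

Section GradedAlgebras.
Variables (k : comPzRingType).

(* The graded (non-unital) associative algebra structures on V. *)
Definition gr_assoc (V : gmod k) : set (V -> V -> V) :=
  [set mul | [/\ forall a x y z, mul (a *: x + y) z = a *: mul x z + mul y z,
                 forall a x y z, mul x (a *: y + z) = a *: mul x y + mul x z,
                 forall p q x y, homog p x -> homog q y -> homog (p + q) (mul x y)
               & forall x y z, mul (mul x y) z = mul x (mul y z)]].
#[global] Arguments gr_assoc V : clear implicits.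

Variable X : gmod k.

Definition args2 (x y : X) : 'I_2 -> X := fun i => if i == ord0 then x else y.

(* The product on Sigma^-1 X with shifted multiplication m2; alg_mulE is the
   defining relation m2(sigma x, sigma y) = (-1)^(|x|+1) sigma(x y). *)
Definition alg_mul (m2 : hom X 2 (-1)) (x y : desusp X) : desusp X :=
  - sigma_inv (m2 (args2 (sigma (gsgn 1 x)) (sigma y))).

Lemma alg_mulE (m2 : hom X 2 (-1)) p (x y : desusp X) : homog p x ->
  m2 (args2 (sigma x) (sigma y)) = ksign k (p + 1) *: sigma (alg_mul m2 x y).
Proof.
move=> hx; rewrite /alg_mul (gsgn_homog 1 hx) mul1r.
have m2l c u v : m2 (args2 (c *: u) v) = c *: m2 (args2 u v).
  have H w : args2 w v = upd (args2 0 v) ord0 w.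
    by apply: funext => i; rewrite /args2 /upd; case: eqP.
  have H0 : m2 (upd (args2 0 v) ord0 0) = 0.
    have := hom_multilin m2 ord0 (args2 0 v) (-1) 0 0.
    by rewrite scaler0 addr0 scaleN1r addNr.
  have := hom_multilin m2 ord0 (args2 0 v) c u 0.
  by rewrite addr0 H0 addr0 -!H.
have s1 : ksign k 1 = -1 by rewrite /ksign expr1.
rewrite /sigma /sigma_inv m2l ksignD s1.
by rewrite mulrN1 scaleNr scalerN opprK scalerA ksign_sq scale1r.
Qed.

End GradedAlgebras.

(* Main.v *)
Require Import Defs.
From HB Require Import structures.
From mathcomp Require Import all_boot all_order all_algebra.
From mathcomp Require Import zify.
From mathcomp Require Import all_classical.
From Stdlib Require Import Relations.

(* A vertex of Map(A_2, R) is a cycle in R_0(2)_{-1}.  Two vertices are joined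
   by an edge iff their cycles are homologous: the faces of an edge represent
   the same class of H(R_1) = E(X), and conversely, if x - y = d b, then Reedy
   fibrancy provides c in R_1 with faces b and 0, and s(y) + d c is an edge
   from x to y.  Hence pi_0 Map(A_2, R) = Hom(X^(tensor 2), X)_{-1}.  If the
   class of q extends over A_3, the image of mu_3 bounds a cycle representing
   q{q}, so q{q} = 0 as E(X) has zero differential; conversely, if q{q} = 0,
   sending mu_3 to 0 extends q.  Finally q{q} = 0 says that the product on
   Sigma^-1 X with shifted multiplication q is associative. *)

Import GRing.Theory.
Local Open Scope classical_set_scope.
Local Open Scope ring_scope.

(** * Cycles and boundaries under partial composition *)

Section OperadHomology.
Local Set Implicit Arguments.
Local Unset Strict Implicit.
Variables (k : comPzRingType) (P : dgOperad k).

(** The derivation rule applied to [op1] composed with itself gives d(1) = d(1) + d(1). *)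
Lemma diff_op1 r (H : 0 = r + 1 :> int) : diff P 1 H (op1 P) = 0.
Proof.
have Dl : r + 0 = r by rewrite addr0.
have Dr : 0 + r = r by rewrite add0r.
have := @diff_circ k P 1 1 1 0 0 0 r r r erefl erefl H H H Dl Dr (op1 P) ord0 (op1 P).
rewrite circ1l circ1r circ1l ksign0 scale1r.
by move/eqP; rewrite -subr_eq0 opprD addrA subrr sub0r oppr_eq0 => /eqP.
Qed.

Lemma boundary0 n p : boundary (0 : P n p).
Proof. by exists (p + 1), erefl, 0; rewrite linear0. Qed.

Lemma boundary_lin n p (a : k) (x y : P n p) :
  boundary x -> boundary y -> boundary (a *: x + y).
Proof.
move=> [q [H [u <-]]] [q' [H' [v <-]]]; subst q q'.
by exists (p + 1), erefl, (a *: u + v); rewrite linearP.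
Qed.

Lemma boundaryD n p (x y : P n p) : boundary x -> boundary y -> boundary (x + y).
Proof. by rewrite -{2}[x]scale1r; exact: boundary_lin. Qed.

Lemma boundaryN n p (x : P n p) : boundary x -> boundary (- x).
Proof.
by move=> bx; rewrite -[- x]addr0 -scaleN1r; exact: boundary_lin bx (boundary0 _ _).
Qed.

Lemma boundary_sum n p (I : Type) (s : seq I) (F : I -> P n p) :
  (forall i, boundary (F i)) -> boundary (\sum_(i <- s) F i).
Proof.
by move=> bF; elim/big_ind: _ => //; [exact: boundary0 | exact: boundaryD].
Qed.

Lemma boundary_circl m n l p q r (E : (m + n = l.+1)%N) (D : p + q = r)
    (x : P m p) i (y : P n q) :
  boundary x -> Defs.cycle y -> boundary (circ E D x i y).
Proof.
move=> [p' [H [u <-]]] cy.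
have D' : p' + q = r + 1 by lia.
have Dq : p' + (q - 1) = r by lia.
have Hq : q = q - 1 + 1 by lia.
exists (r + 1), erefl, (circ E D' u i y).
by rewrite (diff_circ E D' H Hq erefl D Dq) cy circ0r scaler0 addr0.
Qed.

Lemma boundary_circr m n l p q r (E : (m + n = l.+1)%N) (D : p + q = r)
    (x : P m p) i (y : P n q) :
  Defs.cycle x -> boundary y -> boundary (circ E D x i y).
Proof.
move=> cx [q' [H [u <-]]].
have D' : p + q' = r + 1 by lia.
have Dp : (p - 1) + q' = r by lia.
have Hp : p = p - 1 + 1 by lia.
(* The factor [ksign k p] cancels the sign that the differential picks up when it passes [x]. *)
exists (r + 1), erefl, (ksign k p *: circ E D' x i u).
rewrite linearZ /= (diff_circ E D' Hp H erefl Dp D) cx circ0l add0r.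
by rewrite scalerA ksign_sq scale1r.
Qed.

Lemma cycle_lin n p (a : k) (x y : P n p) :
  Defs.cycle x -> Defs.cycle y -> Defs.cycle (a *: x + y).
Proof. by move=> cx cy r H; rewrite linearP cx cy scaler0 addr0. Qed.

Lemma boundary_cycle n p (x : P n p) : boundary x -> Defs.cycle x.
Proof. by move=> [q [H [u <-]]] r H'; exact: diffK. Qed.

(** Telescoping through [x] composed with [y'] leaves two terms, each the composite of a boundary
    with a cycle. *)
Lemma circ_homologous m n l p q r (E : (m + n = l.+1)%N) (D : p + q = r)
    (x x' : P m p) i (y y' : P n q) :
  Defs.cycle x -> Defs.cycle y' -> boundary (x' - x) -> boundary (y' - y) ->
  boundary (circ E D x' i y' - circ E D x i y).
Proof.
move=> cx cy bx b_y.
have -> : circ E D x' i y' - circ E D x i y =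
    circ E D (x' - x) i y' + circ E D x i (y' - y).
  rewrite [x' - x]addrC [y' - y]addrC -!scaleN1r circ_linl circ_linr !scaleN1r.
  by rewrite [- _ + circ E D x' i y']addrC addrACA addNr addr0.
by apply: boundaryD; [exact: boundary_circl | exact: boundary_circr].
Qed.

End OperadHomology.

(** * Maps out of the truncations A_m *)

Section OperadMaps.
Local Set Implicit Arguments.
Local Unset Strict Implicit.
Variable k : comPzRingType.

Lemma dgHom_cycle (P Q : dgOperad k) (f : dgHom P Q) n p (x : P n p) :
  Defs.cycle x -> Defs.cycle (f n p x).
Proof. by move=> cx r H; rewrite -dg_map_diff cx linear0. Qed.

Lemma dgHom_boundary (P Q : dgOperad k) (f : dgHom P Q) n p (x : P n p) :
  boundary x -> boundary (f n p x).
Proof. by move=> [q [H [u <-]]]; exists q, H, (f n q u); rewrite dg_map_diff. Qed.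

Lemma gr_map_brace (P Q : grOperad k) (f : grHom P Q) m n l p q r
    (E : (m + n = l.+1)%N) (D : p + q = r) (x : P m p) (y : P n q) :
  f l r (brace E D x y) = brace E D (f m p x) (f n q y).
Proof. by rewrite /brace linear_sum; apply: eq_bigr => i _; exact: gr_map_circ. Qed.

Variables (A : Ainfty k) (m : nat).

(** Everything in A_m is built from the generators by operations that DG-operad maps preserve. *)
Lemma Atrunc_hom_ext (P : dgOperad k) (f g : dgHom (Atrunc A m) P) :
  (forall i (H : (2 <= i <= m)%N), f i (-1) (Asub_mu A H) = g i (-1) (Asub_mu A H)) ->
  f = g.
Proof.
move=> fg; apply: dgHom_ext => n p x.
(* Quantifying over a second membership proof [H] lets the induction run on elements of A, with
   [val_inj] identifying the subtype elements in each case. *)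
suff K : forall n p (y : A n p), Agen m y -> forall H : Agen m y,
    f n p (mkAsub H) = g n p (mkAsub H).
  have := K _ _ _ (Asub_gen x) (Asub_gen x).
  by rewrite (_ : mkAsub _ = x) //; exact: val_inj.
move=> {n p x} n p y; elim=> {n p y}.
- move=> i Hi H; rewrite (_ : mkAsub H = Asub_mu A Hi); last exact: val_inj.
  exact: fg.
- move=> H; rewrite (_ : mkAsub H = op1 (Atrunc A m)); last exact: val_inj.
  by rewrite !gr_map1.
- move=> n p H; rewrite (_ : mkAsub H = 0); last exact: val_inj.
  by rewrite !linear0.
- move=> n p a x y hx IHx hy IHy H.
  rewrite (_ : mkAsub H = a *: mkAsub hx + mkAsub hy); last exact: val_inj.
  by rewrite !linearP IHx IHy.
- move=> n o l p q r E D x i y hx IHx hy IHy H.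
  rewrite (_ : mkAsub H = @circ _ (Atrunc A m) _ _ _ _ _ _ E D (mkAsub hx) i (mkAsub hy));
    last exact: val_inj.
  by rewrite !gr_map_circ IHx IHy.
- move=> n p r H' x hx IHx H.
  rewrite (_ : mkAsub H = diff (Atrunc A m) n H' (mkAsub hx)); last exact: val_inj.
  by rewrite !dg_map_diff IHx.
Qed.

(** Freeness of A_infinity gives a graded map on all of A, which is then restricted to A_m;
    compatibility with d propagates from the generators by the derivation rule. *)
Lemma Atrunc_hom_exists (P : dgOperad k) (a : forall n, P n (-1)) :
  (forall n, (2 <= n <= m)%N -> diff P n diff_deg (a n) =
     \sum_(p < n.+2 | (2 <= p)%N && (2 <= n.+1 - p)%N)
       brace (brace_arity p) brace_deg (a p) (a (n.+1 - p)%N)) ->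
  exists f : dgHom (Atrunc A m) P,
    forall i (H : (2 <= i <= m)%N), f i (-1) (Asub_mu A H) = a i.
Proof.
move=> da; have [[f fa] _] := mu_free A a.
(* The claim is confined to elements generated by mu_2, ..., mu_m, since the formula for d(a_n) is
   assumed only for these arities. *)
have fd n p (x : A n p) : Agen m x -> forall r (H : p = r + 1),
    f n r (diff A n H x) = diff P n H (f n p x).
  elim=> {n p x}.
  - move=> i /[dup] Hi /andP[i2 _] r H.
    have Er : r = -2 by lia.
    subst r; rewrite (eq_irrelevance H diff_deg) mu_diff // fa // da //.
    rewrite linear_sum; apply: eq_bigr => p /andP[p2 q2].
    by rewrite gr_map_brace !fa.
  - by move=> r H; rewrite gr_map1 !diff_op1 linear0.
  - by move=> n p r H; rewrite !linear0.
  - by move=> n p c x y _ IHx _ IHy r H; rewrite !linearP IHx IHy.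
  - move=> n o l p q r E D x i y _ IHx _ IHy r' H.
    have Hp : p = p - 1 + 1 by lia.
    have Hq : q = q - 1 + 1 by lia.
    have Dp : p - 1 + q = r' by lia.
    have Dq : p + (q - 1) = r' by lia.
    rewrite gr_map_circ !(diff_circ E D Hp Hq H Dp Dq).
    by rewrite linearD linearZ /= !gr_map_circ IHx IHy.
  - by move=> n p r H x _ IHx s H'; rewrite diffK linear0 IHx diffK.
pose g := grComp f (grAtrunc_incl A m).
have gd n p r (H : p = r + 1) (x : Atrunc A m n p) :
    g n r (diff (Atrunc A m) n H x) = diff P n H (g n p x).
  exact: fd (Asub_gen x) r H.
by exists (DgHom gd) => i H; apply: fa; case/andP: H.
Qed.

End OperadMaps.

(** * Prescribing the two faces of a 1-simplex *)

Section EdgeLifting.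
Local Set Implicit Arguments.
Local Unset Strict Implicit.
Variable k : comPzRingType.

Definition dconst n : dmap n 0 := @Dmap n 0 (fun _ => ord0) (fun _ _ _ => leqnn _).

Lemma dmap_ext m n (t u : dmap m n) : t =1 u -> t = u.
Proof.
case: t u => t ht [u hu] /= /funext E; subst u; congr Dmap; exact: Prop_irrelevance.
Qed.

Lemma non_dsurj_const m (t : dmap m 1) : ~ dsurj t -> forall i j, t i = t j.
Proof.
move=> nt i j; apply: contrapT => tij; apply: nt => h.
have [<-|hi] := eqVneq (t i) h; first by exists i.
exists j; apply: val_inj; move: tij hi => /eqP; rewrite -!val_eqE /=.
by have := ltn_ord (t i); have := ltn_ord (t j); have := ltn_ord h; lia.
Qed.

(** The matching object in level 1 is the product of two copies of level 0: a non-surjective map to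
    [1] is constant, so it factors through one of the two vertices. *)
Lemma reedy_fibrant_faces (O : sdgOperad k) : reedy_fibrant O ->
  forall a p (b0 b1 : O 0%N a p), exists b : O 1%N a p,
    so_act O (dface (ord_max : 'I_2)) a p b = b0 /\
    so_act O (dface (ord0 : 'I_2)) a p b = b1.
Proof.
move=> fO a p b0 b1.
(* For a constant [t], its value at 0 tells which vertex it hits; the family is the degeneracy of
   the element prescribed there. *)
pose x m (t : dmap m 1) : O m a p :=
  so_act O (dconst m) a p (if t ord0 == ord0 then b0 else b1).
have [l m t u nt|b hb] := fO 1%N a p x.
  rewrite /x /= (non_dsurj_const nt (u ord0) ord0) -so_act_comp.
  by congr (so_act O _ a p _); exact: dmap_ext.
have nface (i : 'I_2) : ~ dsurj (dface i).
  by move=> /(_ i) [j] /= /eqP; rewrite eq_sym; exact/negP/neq_lift.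
have c0 : dconst 0 = did 0 by apply: dmap_ext => i; rewrite (ord1 i).
by exists b; rewrite !hb // /x c0 !so_act_id.
Qed.

End EdgeLifting.

(** * Homology classes in a resolution of an operad with zero differential *)

Section HomologyClasses.
Local Set Implicit Arguments.
Local Unset Strict Implicit.
Variables (k : comPzRingType) (Q : dgOperad k) (R : resolution Q).
Hypothesis Q0 : forall n p r (H : p = r + 1) (x : Q n p), diff Q n H x = 0.

(* The homology class of y corresponds to q under H(R_d) = Q. *)
Definition represents d n p (y : R d n p) (q : Q n p) : Prop :=
  boundary (res_aug R d n p q - y).

Lemma represents_aug d n p (q : Q n p) : represents (res_aug R d n p q) q.
Proof. by rewrite /represents subrr; exact: boundary0. Qed.

Lemma represents_exists d n p (y : R d n p) : Defs.cycle y -> exists q, represents y q.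
Proof. by case: (res_aug_qi R d n p) => _ h /h[q _ hq]; exists q. Qed.

(** Injectivity of the augmentation on homology makes [q] a boundary in [Q], where the differential
    vanishes. *)
Lemma boundary_aug_eq0 d n p (q : Q n p) : boundary (res_aug R d n p q) -> q = 0.
Proof.
move=> bq; have [h _] := res_aug_qi R d n p.
have [|r [H [u <-]]] := h q _ bq; first by move=> r H; exact: Q0.
exact: Q0.
Qed.

Lemma represents_uniq d n p (y : R d n p) q q' :
  represents y q -> represents y q' -> q = q'.
Proof.
move=> h h'; apply/eqP; rewrite -subr_eq0; apply/eqP.
apply: (@boundary_aug_eq0 d); rewrite linearB /=.
have := boundaryD h (boundaryN h').
by rewrite opprB addrA subrK.
Qed.

Lemma represents_act d e (t : dmap d e) n p (y : R e n p) q :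
  represents y q -> represents (so_act R t n p y) q.
Proof.
by move=> /(dgHom_boundary (so_act R t)); rewrite linearB /= res_aug_act.
Qed.

Lemma aug_cycle d n p (q : Q n p) : Defs.cycle (res_aug R d n p q).
Proof. by apply: dgHom_cycle => r H; exact: Q0. Qed.

(** The brace descends to homology, by [circ_homologous] in each summand. *)
Lemma represents_brace m n l p q r (E : (m + n = l.+1)%N) (D : p + q = r)
    d (x : R d m p) (y : R d n q) x' y' : Defs.cycle x ->
  represents x x' -> represents y y' -> represents (brace E D x y) (brace E D x' y').
Proof.
move=> cx hx hy; rewrite /represents gr_map_brace /brace -sumrB.
by apply: boundary_sum => i; apply: circ_homologous => //; exact: aug_cycle.
Qed.

Lemma represents_boundary d n p (y : R d n p) q :
  boundary y -> represents y q -> q = 0.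
Proof.
move=> hy h; apply: (@boundary_aug_eq0 d).
by have := boundaryD h hy; rewrite subrK.
Qed.

End HomologyClasses.

(** * Maps out of A_2 and A_3 *)

Section LowTruncations.
Local Set Implicit Arguments.
Local Unset Strict Implicit.
Variables (k : comPzRingType) (A : Ainfty k).

(** With the truncation written [m.+2], the bounds on the index 2 hold by computation, whence
    [isT]. *)
Definition mu2 m : Atrunc A m.+2 2 (-1) := @Asub_mu k A m.+2 2 isT.

(** The sum for d(mu_2) is empty: p + q = 3 has no solution with p, q >= 2. *)
Lemma mu2_cycle m : Defs.cycle (mu2 m).
Proof.
move=> r H; have Er : r = -2 by lia.
subst r; rewrite (eq_irrelevance H diff_deg); apply: val_inj => /=.
rewrite mu_diff // big_pred0 // => -[[|[|[|[|]]]] ?] //.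
Qed.

Lemma sum_arity3 (V : zmodType) (F : 'I_5 -> V) :
  \sum_(p < 5 | (2 <= p)%N && (2 <= 4 - p)%N) F p = F (@Ordinal 5 2 isT).
Proof. by apply: big_pred1 => -[[|[|[|[|[|]]]]] ?]. Qed.

(** It is d(mu_3), whose only summand has p = q = 2. *)
Lemma mu2_brace_boundary m :
  boundary (brace (erefl : (2 + 2 = 3.+1)%N) brace_deg (mu2 m.+1) (mu2 m.+1)).
Proof.
exists (-1), diff_deg, (@Asub_mu k A m.+3 3 isT); apply: val_inj.
rewrite /= mu_diff // sum_arity3.
rewrite -[RHS]/(grAtrunc_incl A m.+3 3 (-2) _) gr_map_brace.
by congr brace; exact: eq_irrelevance.
Qed.

Lemma A2_hom_exists (P : dgOperad k) (x : P 2 (-1)) :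
  Defs.cycle x -> exists f : dgHom (Atrunc A 2) P, f 2 (-1) (mu2 0) = x.
Proof.
move=> cx; pose a n : P n (-1) :=
  match n with 2 => x | _ => 0 end.
have [|f fa] := @Atrunc_hom_exists _ A 2 P a; last by exists f; exact: fa.
case=> [|[|[|]]] // _; rewrite cx big_pred0 // => -[[|[|[|[|]]]] ?] //.
Qed.

Lemma A2_hom_ext (P : dgOperad k) (f g : dgHom (Atrunc A 2) P) :
  f 2 (-1) (mu2 0) = g 2 (-1) (mu2 0) -> f = g.
Proof.
move=> fg; apply: Atrunc_hom_ext => i H; have Ei : i = 2 by lia.
by subst i; rewrite (bool_irrelevance H isT).
Qed.

Lemma A3_hom_exists (P : dgOperad k) (x : P 2 (-1)) : Defs.cycle x ->
  brace (erefl : (2 + 2 = 3.+1)%N) brace_deg x x = 0 ->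
  exists f : dgHom (Atrunc A 3) P, f 2 (-1) (mu2 1) = x.
Proof.
(* The default value 0 is in particular the image of mu_3, so the condition in arity 3 is exactly
   [bx]. *)
move=> cx bx; pose a n : P n (-1) :=
  match n with 2 => x | _ => 0 end.
have [|f fa] := @Atrunc_hom_exists _ A 3 P a; last by exists f; exact: fa.
case=> [|[|[|[|]]]] // _.
  by rewrite cx big_pred0 // => -[[|[|[|[|]]]] ?].
rewrite sum_arity3 linear0 -[LHS]bx /=.
by congr brace; exact: eq_irrelevance.
Qed.

End LowTruncations.

(** * Path components of the mapping space out of A_2 *)

Section MapComponents.
Local Set Implicit Arguments.
Local Unset Strict Implicit.
Variables (k : comPzRingType) (A : Ainfty k) (Q : dgOperad k) (R : resolution Q).
Hypothesis Q0 : forall n p r (H : p = r + 1) (x : Q n p), diff Q n H x = 0.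
Local Notation M := (Map (Atrunc A 2) R).

Lemma pi0_class_eq (S : sset) (x y : S 0%N) :
  pi0_class x = pi0_class y <-> connected_by x y.
Proof.
split=> [/(congr1 sval) /= /seteqP[_ /(_ y)] h|xy].
  by apply: h; exact: rst_refl.
apply: eq_exist => /=; apply/seteqP; split=> z /= h.
  by apply: rst_trans (rst_sym _ _ _ _ xy) h.
exact: rst_trans xy h.
Qed.

(** The edge itself gives a cycle in level 1; its class is carried to both faces because the
    augmentation commutes with the simplicial maps. *)
Lemma edge_represents (f g : M 0%N) q : Defs.edge f g ->
  represents (f 2 (-1) (mu2 A 0)) q <-> represents (g 2 (-1) (mu2 A 0)) q.
Proof.
move=> [e [<- <-]].
have [q' hq'] := represents_exists (dgHom_cycle e (@mu2_cycle _ A 0)).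
have h t : represents (so_act R t 2 (-1) (e 2 (-1) (mu2 A 0))) q <-> q = q'.
  split=> [h|->]; last exact: represents_act.
  by apply: represents_uniq Q0 _ _ _ _ _ _ h _; exact: represents_act.
by rewrite /= !h.
Qed.

Lemma connected_represents (f g : M 0%N) q : connected_by f g ->
  represents (f 2 (-1) (mu2 A 0)) q <-> represents (g 2 (-1) (mu2 A 0)) q.
Proof.
elim=> {f g} [f g|f|f g _|f g h _ fg _ gh]; [exact: edge_represents|by []|by symmetry|].
exact: iff_trans fg gh.
Qed.

Lemma represents_edge (f g : M 0%N) q :
  represents (f 2 (-1) (mu2 A 0)) q -> represents (g 2 (-1) (mu2 A 0)) q ->
  Defs.edge f g.
Proof.
move=> hf hg.
(* The representative of [q] cancels, so d(b) is the value of [f] minus the value of [g]. *)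
have [r [H [b bE]]] := boundaryD hg (boundaryN hf).
have [c [c0 c1]] := @reedy_fibrant_faces _ R (@res_fib _ _ R) _ _ b 0.
(* The face opposite the last vertex turns [y] into g + d(b) = f, the other one into g + d(0) =
   g. *)
pose y := so_act R (dconst 1) 2 (-1) (g 2 (-1) (mu2 A 0)) + diff (R 1%N) 2 H c.
have cy : Defs.cycle y.
  rewrite /y -[X in X + _]scale1r; apply: cycle_lin.
    by do 2 apply: dgHom_cycle; exact: mu2_cycle.
  by apply: boundary_cycle; exists r, H, c.
have sI i : dcomp (dconst 1) (dface i) = did 0 by apply: dmap_ext => j; rewrite !ord1.
have [e eE] := A2_hom_exists A cy.
exists e; split; apply: A2_hom_ext; rewrite /= eE linearD /= -so_act_comp sI so_act_id.
  by rewrite dg_map_diff c0 bE opprB addrC addrAC subrK addrC subrK.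
by rewrite dg_map_diff c1 linear0 addr0.
Qed.

(** The brace of the value of [f] with itself represents q{q}, and the image of mu_3 bounds it. *)
Lemma A3_hom_represents d (f : dgHom (Atrunc A 3) (R d)) q :
  represents (f 2 (-1) (mu2 A 1)) q ->
  brace (erefl : (2 + 2 = 3.+1)%N) brace_deg q q = 0.
Proof.
move=> h; apply: represents_boundary Q0 _ _ _ _ _ _ (represents_brace Q0 _ _ _ h h).
  by rewrite -gr_map_brace; apply: dgHom_boundary; exact: mu2_brace_boundary.
by apply: dgHom_cycle; exact: mu2_cycle.
Qed.

End MapComponents.

(** * Shifted multiplications and products on the desuspension *)

Section ShiftedMultiplication.
Local Set Implicit Arguments.
Local Unset Strict Implicit.
Variables (k : comPzRingType) (X : gmod k).
Implicit Types (q : Defs.hom X 2 (-1)) (x y z : X).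
Local Notation s := (@gsgn k X 1).

Lemma ksign1 : ksign k 1 = -1. Proof. by rewrite /ksign expr1. Qed.

Lemma gsgnN (e : int) x : gsgn (- e) x = gsgn e x.
Proof. by apply: gpr_ext => p; rewrite !gpr_gsgn /ksign mulNr abszN. Qed.

Lemma gsgn1K x : s (s x) = x.
Proof. by rewrite -{1}gsgnN gsgnD addNr gsgn0. Qed.

(** Desuspension lowers degrees by one, which flips the parity. *)
Lemma gsgn_desusp x : @gsgn k (desusp X) 1 x = - s x.
Proof.
apply: (@gpr_ext k (desusp X)) => p; rewrite gpr_gsgn mul1r.
rewrite -[RHS]/(gpr X (p + 1) (- s x)) linearN /= gpr_gsgn mul1r.
by rewrite ksignD ksign1 mulrN1 scaleNr opprK.
Qed.

Lemma args2_updl x y u : args2 u y = upd (args2 x y) ord0 u.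
Proof. by apply: funext => i; rewrite /args2 /upd; case: eqP. Qed.

Lemma args2_updr x y u : args2 x u = upd (args2 x y) ord_max u.
Proof. by apply: funext => -[[|[|]] i]. Qed.

Lemma args2_lin_l q a x y z :
  q (args2 (a *: x + y) z) = a *: q (args2 x z) + q (args2 y z).
Proof. by have := hom_multilin q ord0 (args2 0 z) a x y; rewrite -!args2_updl. Qed.

Lemma args2_lin_r q a x y z :
  q (args2 x (a *: y + z)) = a *: q (args2 x y) + q (args2 x z).
Proof. by have := hom_multilin q ord_max (args2 x 0) a y z; rewrite -!args2_updr. Qed.

Lemma args2_oppl q x y : q (args2 (- x) y) = - q (args2 x y).
Proof.
have q0 : q (args2 0 y) = 0.
  by have := args2_lin_l q (-1) 0 0 y; rewrite scaler0 addr0 scaleN1r addNr.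
by rewrite -[- x]addr0 -scaleN1r args2_lin_l q0 addr0 scaleN1r.
Qed.

Lemma args2_eta (x : 'I_2 -> X) : x = args2 (x ord0) (x ord_max).
Proof.
by apply: funext => -[[|[|]] i] //=; rewrite /args2 /=; congr x; exact: val_inj.
Qed.

(** The sign from the degree shift cancels the one in [alg_mul]; since [s] is an involution, this
    also makes [q] recoverable from its product. *)
Lemma alg_mul_gsgn q x y : alg_mul q x y = q (args2 (s x) y).
Proof. by rewrite /alg_mul /sigma /sigma_inv gsgn_desusp args2_oppl opprK. Qed.

Lemma alg_mul_inj q q' : alg_mul q = alg_mul q' -> q = q'.
Proof.
move=> E; apply: hom_ext => x; rewrite (args2_eta x) -[x ord0]gsgn1K.
by rewrite -!alg_mul_gsgn E.
Qed.

Lemma hom_gsgn2 q x y : s (q (args2 x y)) = - q (args2 (s x) (s y)).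
Proof.
rewrite hom_gsgn mulr1 /ksign expr1 scaleN1r; congr (- hval q _).
by apply: funext => -[[|[|]] i].
Qed.

(** Moving [s] past [q], of degree -1, costs a sign that turns the sum in q{q} into an associator.
    The twist of the middle argument absorbs the [s] that the products apply to it. *)
Lemma brace_self_alg_mul q (t : 'I_3 -> X) :
  let x := xat t 0 in let y := s (xat t 1) in let z := xat t 2 in
  (@brace k (EndOp X) _ _ _ _ _ _ (erefl : (2 + 2 = 3.+1)%N) brace_deg q q : Defs.hom X 3 (-2)) t =
  alg_mul q x (alg_mul q y z) - alg_mul q (alg_mul q x y) z.
Proof.
move=> x y z.
rewrite !alg_mul_gsgn hom_gsgn2 args2_oppl opprK /x /y !gsgn1K addrC.
rewrite /brace !big_ord_recl big_ord0 addr0.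
have L : circ_fun (-1) q (ord0 : 'I_2) q t =
    q (args2 (q (args2 (xat t 0) (xat t 1))) z).
  rewrite /circ_fun; congr (hval q _); apply: funext => -[[|[|]] i] //.
  rewrite /circ_arg /args2 /=; congr (hval q _); apply: funext => -[[|[|]] j] //.
have N : circ_fun (-1) q (lift ord0 (ord0 : 'I_1) : 'I_2) q t =
    q (args2 (s (xat t 0)) (q (args2 (xat t 1) z))).
  rewrite /circ_fun; congr (hval q _); apply: funext => -[[|[|]] i] //.
    by rewrite /circ_arg /args2 /= gsgnN.
  rewrite /circ_arg /args2 /=; congr (hval q _); apply: funext => -[[|[|]] j] //.
by rewrite -[LHS]/(circ_fun _ _ _ _ t + circ_fun _ _ _ _ t) L N.
Qed.

Lemma alg_mul_assocP q :
  gr_assoc (desusp X) (alg_mul q) <->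
  @brace k (EndOp X) _ _ _ _ _ _ (erefl : (2 + 2 = 3.+1)%N) brace_deg q q = 0.
Proof.
split=> [[_ _ _ assoc]|q0].
  by apply: hom_ext => t; rewrite brace_self_alg_mul assoc subrr.
split=> [a x y z|a x y z|p r x y hx hy|x y z].
- by rewrite !alg_mul_gsgn -args2_lin_l -gsgn_lin.
- by rewrite !alg_mul_gsgn -args2_lin_r.
- rewrite alg_mul_gsgn.
  (* Degrees p and r in the desuspension are p + 1 and r + 1 in [X], and [q] lowers the total by
     one. *)
  have D : p + r + 1 = \sum_(i < 2) (if i == ord0 then p + 1 else r + 1) - 1.
    by rewrite big_ord_recl big_ord1 /=; lia.
  rewrite /homog /= D; apply: hom_deg => i; rewrite /args2; case: ifP => _ //.
  exact: homog_gsgn.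
(* Twisting the middle entry in advance makes the associator come out at x, y, z, as [s] squares to
   the identity. *)
pose t (i : 'I_3) := nth 0 [:: x; s y; z] i.
have := brace_self_alg_mul q t; rewrite q0 /t !xat_fun //= gsgn1K.
by move/esym/subr0_eq.
Qed.

(** The formula of [alg_mul_gsgn] is solved for [q], and the result is multilinear of degree -1. *)
Lemma gr_assoc_alg_mul mul : gr_assoc (desusp X) mul -> exists q, alg_mul q = mul.
Proof.
move=> [mull mulr mulh _].
pose f (x : 'I_2 -> X) : X := mul (s (x ord0)) (x ord_max).
have mf : multilin f.
  move=> [[|[|]] i] x a u v //; rewrite /f /upd -!val_eqE /=.
    by rewrite gsgn_lin; exact: mull.
  exact: mulr.
have df : has_deg (-1) f.
  move=> p x hx.
  have h0 : @homog k (desusp X) (p ord0 - 1) (s (x ord0)).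
    by rewrite /homog /= subrK; exact: homog_gsgn.
  have h1 : @homog k (desusp X) (p ord_max - 1) (x ord_max).
    by rewrite /homog /= subrK; exact: hx.
  have D : \sum_(i < 2) p i + -1 = p ord0 - 1 + (p ord_max - 1) + 1.
    by rewrite big_ord_recr big_ord1 /= (_ : widen_ord _ _ = ord0); [lia | exact: val_inj].
  by rewrite D; exact: mulh h0 h1.
exists (Defs.Hom (mkhom_subproof mf df)).
apply: funext => x; apply: funext => y; rewrite alg_mul_gsgn.
by rewrite /= /f /args2 /= gsgn1K.
Qed.

End ShiftedMultiplication.

(** * The bijection from E_2^{00} to associative products *)

Theorem proposition6p4 (k : comPzRingType) (X : gmod k) (Ainf : Ainfty k)
    (phi : dgHom Ainf (EndOp X)) (R : resolution (EndOp X)) :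
  let T := Ainf_tower R phi in
  exists Phi : pi0 (T 0%N) -> (desusp X -> desusp X -> desusp X),
    [/\ set_bij (BK_E00 T 2) (gr_assoc (desusp X)) Phi,
        forall f : dgHom (Atrunc Ainf 3) (EndOp X),
          Phi (pi0_class (Map_vertex R (dgComp f (Aincl Ainf (isT : 2 <= 3)%N)))) =
            alg_mul (f 2 (-1) (@Asub_mu k Ainf 3 2 isT))
      & Phi (BK_base T) = alg_mul (phi 2 (-1) (mu Ainf 2))].
Proof.
move=> T.
have Q0 n p r (H : p = r + 1) (x : EndOp X n p) : diff (EndOp X) n H x = 0 by [].
pose rep (f : T 0%N 0%N) (q : EndOp X 2 (-1)) := represents (f 2 (-1) (mu2 Ainf 0)) q.
have repE f : exists q, rep f q.
  exact: represents_exists (dgHom_cycle f (@mu2_cycle _ Ainf 0)).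
have rep_uniq f q q' : rep f q -> rep f q' -> q = q'.
  by move=> h h'; exact: represents_uniq Q0 _ _ _ _ _ _ h h'.
have conn f g : connected_by f g -> forall q, rep f q <-> rep g q.
  by move=> fg q; exact: connected_represents Q0 _ _ _ fg.
(* Homology classes are constant on components, so one [q] serves all vertices of a component. *)
have /choice[cls clsP] : forall C : pi0 (T 0%N), exists q, forall f, sval C f -> rep f q.
  case=> C /= [f ->]; have [q fq] := repE f.
  by exists q => g /= fg; apply/(conn _ _ fg).
have cls_class f q : rep f q -> cls (pi0_class f) = q.
  by move=> fq; apply: rep_uniq fq; apply: clsP => /=; exact: rst_refl.
have cls_vertex (f : dgHom (Atrunc Ainf 2) (EndOp X)) :
    cls (pi0_class (Map_vertex R f)) = f 2 (-1) (mu2 Ainf 0).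
  by apply: cls_class; exact: represents_aug.
exists (fun C => alg_mul (cls C)); split; last 2 first.
- move=> f; rewrite cls_vertex /=; congr (alg_mul (dg_map f 2 (-1) _)).
  exact: val_inj.
- by rewrite [cls _]cls_vertex.
have pi0P (S : sset) (C : pi0 S) : exists f, C = pi0_class f.
  by case: C => C [f fE]; subst C; exists f.
have mu2_res (h : (2 <= 3)%N) : Aincl Ainf h 2 (-1) (mu2 Ainf 0) = mu2 Ainf 1.
  exact: val_inj.
split.
(* A component that lifts to A_3 has q{q} = 0, hence an associative product. *)
- move=> _ [C _ <-]; have [f ->] := pi0P _ C; rewrite pi0_mapE /=.
  have [q fq] := repE (tw_res T (leq0n 1) 0%N f).
  rewrite (cls_class _ _ fq); apply/alg_mul_assocP.
  apply: (@A3_hom_represents _ Ainf _ R Q0 0%N f).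
  by rewrite -(mu2_res (leq0n 1)).
(* Equal products give equal classes, and vertices with the same class are joined by a single
   edge. *)
- move=> C C' _ _ /alg_mul_inj CC'.
  have [f fE] := pi0P _ C; have [g gE] := pi0P _ C'.
  have [[q fq] [q' gq]] := (repE f, repE g).
  move: CC'; rewrite fE gE (cls_class _ _ fq) (cls_class _ _ gq) => E; subst q'.
  by apply/pi0_class_eq/rst_step; exact: represents_edge fq gq.
(* An associative product yields a strict map from A_3 to the endomorphism operad; its vertex
   provides the lift. *)
- move=> mul /[dup] mulA /gr_assoc_alg_mul[q qE]; subst mul.
  have cq : Defs.cycle (q : EndOp X 2 (-1)) by move=> r H; exact: Q0.
  have [f fq] := A3_hom_exists Ainf cq (iffLR (alg_mul_assocP q) mulA).
  exists (pi0_class (Map_vertex R (dgComp f (Aincl Ainf (isT : 2 <= 3)%N)))).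
    exists (pi0_class (Map_vertex R f)) => //.
    rewrite pi0_mapE; congr pi0_class; apply: dgHom_ext => a p x.
    by congr (res_aug R 0%N a p (dg_map f a p _)); exact: val_inj.
  by rewrite cls_vertex -fq -(mu2_res isT).
Qed.
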